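(* Suppose there exist constants $\delta>0$ and $0<\varepsilon<1$ such that $D(\delta|i,a,b)\le 1-\varepsilon$ for all $(i,a,b)\in S\times A\times B$. Given any $z\in\mathbb R^{|K|}$, there exists $\sigma^*\in\Sigma$ such that for every $i\in S$ $$U(z,i,\hat\pi,\sigma^* )\le U^*(z,i),\qquad\forall\,\hat\pi\in\hat\Pi,$$ i.e. $\sigma^*$ is an optimal policy for Player 2 in the dual game $G^\#(z)$.
   Context: Model. $K,S,A,B$ are finite nonempty sets (game types, states, actions of Player 1, actions of Player 2). For a finite set $E$, $\mathcal P(E)$ is the set of probability distributions on $E$. $Q(\cdot,\cdot|i,a,b)$ is a semi-Markov kernel on $[0,\infty)\times S$ given $S\times A\times B$: for all $i,j,a,b$, $t\mapsto Q(t,j|i,a,b)$ is nondecreasing, right continuous, nonnegative, with $Q(0,j|i,a,b)=0$; $\sum_{j}Q(t,j|i,a,b)\le 1$ for all $t$; and $\sum_j\lim_{t\to\infty}Q(t,j|i,a,b)=1$. Put $D(t|i,a,b):=\sum_{j\in S}Q(t,j|i,a,b)$. The payoff rate is $c:K\times S\times A\times B\to[0,\infty)$, and $\alpha>0$ is a fixed discount factor. Policies. $\mathcal H_n=(S\times A\times B)^n\times S$ is the set of histories $h_n=(i_0,a_0,b_0,\dots,a_{n-1},b_{n-1},i_n)$. $\Pi$ is the set of families $\pi=\{\pi_n^{(k)}:k\in K,n\ge0\}$ of stochastic kernels $\pi_n^{(k)}(\cdot|h_n)\in\mathcal P(A)$, $h_n\in\mathcal H_n$. $\Sigma$ is the set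 of policies of Player 2, i.e. families $\sigma=\{\sigma_n:n\ge0\}$ of stochastic kernels $\sigma_n(\cdot|h_n)\in\mathcal P(B)$. Probability. On $\Omega=K\times(S\times A\times B\times[0,\infty))^\infty$ with product $\sigma$-algebra, for $\omega=(k,i_0,a_0,b_0,t_1,i_1,a_1,b_1,t_2,\dots)$ put $\kappa=k$, $X_n=i_n$, $A_n=a_n$, $B_n=b_n$, $T_0=0$, $T_{n}=\sum_{m=1}^{n}t_m$, $H_n=(X_0,A_0,B_0,\dots,A_{n-1},B_{n-1},X_n)$, $T_\infty=\lim_nT_n$. For $p\in\mathcal P(K)$, $i\in S$, $\pi\in\Pi$, $\sigma\in\Sigma$, $\mathbb P_{p,i}^{\pi,\sigma}$ is the unique probability measure with $\mathbb P(X_0=i,\kappa=k)=p_k$; $\mathbb P(A_n=a,B_n=b|\kappa,H_n,T_n)=\pi_n^{(\kappa)}(a|H_n)\sigma_n(b|H_n)$; $\mathbb P(T_{n+1}-T_n\le t,X_{n+1}=j|\kappa,H_n,T_n,A_n,B_n)=Q(t,j|X_n,A_n,B_n)$. For $t\in[T_n,T_{n+1})$ the continuous-time processes (written with subscript $t$) take the values $X_n,A_n,B_n$. Dual game $G^\#(z)$, $z=\{z(k)\}_{k\in K}\in\mathbb R^{|K|}$. Player 1's policies are pairs $\hat\pi=(\rho,\pi)\in\hat\Pi:=\mathcal P(K|S)\times\Pi$, where $\rho=\{\rho_i\in\mathcal P(K):i\in S\}$; Player 2's policies are $\Sigma$. Put $\mathbb P_i^{\hat\pi,\sigma}:=\mathbb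 P_{\rho_i,i}^{\pi,\sigma}$ with expectation $\mathbb E_i^{\hat\pi,\sigma}$, and $U(z,i,\hat\pi,\sigma)=\mathbb E_i^{\hat\pi,\sigma}\big[\int_0^{T_\infty}e^{-\alpha t}(c(\kappa,X_t,A_t,B_t)-z(\kappa))\,dt\big]$. $\underline U(z,i)=\sup_{\hat\pi\in\hat\Pi}\inf_{\sigma\in\Sigma}U(z,i,\hat\pi,\sigma)$, $\overline U(z,i)=\inf_{\sigma\in\Sigma}\sup_{\hat\pi\in\hat\Pi}U(z,i,\hat\pi,\sigma)$. Under the hypothesis of the claim these coincide for all $(z,i)$, and the common value is $U^*(z,i)$. A policy $\sigma^*\in\Sigma$ is optimal for Player 2 in $G^\#(z)$ if $\sup_{\hat\pi\in\hat\Pi}U(z,i,\hat\pi,\sigma^* )\le\overline U(z,i)$ for all $i\in S$. *)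

(* Defs.v *)
From HB Require Import structures.
From mathcomp Require Export all_boot all_order all_algebra.
From mathcomp Require Export all_classical all_reals all_analysis.

Set Implicit Arguments.
Unset Strict Implicit.
Unset Printing Implicit Defensive.

Import Order.TTheory GRing.Theory Num.Theory.
Import numFieldNormedType.Exports.

Local Open Scope classical_set_scope.
Local Open Scope ring_scope.

(* Finite nonempty sets.  The distinguished point only witnesses nonemptiness:
   measurable spaces have to be pointed in MathComp-Analysis. *)
#[short(type="pointedFinType")]
HB.structure Definition PointedFinite := {T of Finite T & isPointed T}.

(* This carrier is what {nonneg R} unfolds to. *)
HB.instance Definition _ (R : realType) :=
  isPointed.Build (Itv.def (@Itv.num_sem R) (Itv.Real `[0%Z, +oo[))
    (0%:nng : {nonneg R}).

Record dist (R : realType) (E : finType) := Dist {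
  mass :> E -> R;
  mass_ge0 : forall e, 0 <= mass e;
  mass_sum1 : \sum_e mass e = 1 }.

Section Game.
Variables (R : realType) (K S A B : pointedFinType).

(* [Q t j i a b] stands for Q(t, j | i, a, b); only its values at t >= 0
   matter. *)
Definition semi_markov_kernel (Q : R -> S -> S -> A -> B -> R) : Prop :=
  [/\ forall j i a b,
        [/\ forall s t : R, 0 <= s -> s <= t -> Q s j i a b <= Q t j i a b,
            forall t : R, 0 <= t -> Q s j i a b @[s --> t^'+] --> Q t j i a b,
            forall t : R, 0 <= t -> 0 <= Q t j i a b
          & Q 0 j i a b = 0],
      forall (t : R) i a b, 0 <= t -> \sum_j Q t j i a b <= 1
    & forall i a b, \sum_j lim (Q t j i a b @[t --> +oo]) = 1].

Definition sojourn_cdf (Q : R -> S -> S -> A -> B -> R) (t : R) i a b : R :=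
  \sum_j Q t j i a b.

(* (i_0, a_0, b_0, ..., i_{n-1}, a_{n-1}, b_{n-1}) and i_n *)
Definition history (n : nat) : Type := (n.-tuple (S * A * B) * S)%type.

Definition policy1 : Type := K -> forall n, history n -> dist R A.
Definition policy2 : Type := forall n, history n -> dist R B.
Definition dual_policy1 : Type := ((S -> dist R K) * policy1)%type.

(* The n-th block of a path is (i_n, a_n, b_n, t_{n+1}). *)
Definition path_space : Type := (K * (nat -> S * A * B * {nonneg R}))%type.

Implicit Types w : path_space.
Definition kappa w : K := w.1.
Definition stage n w : S * A * B := (w.2 n).1.
Definition X n w : S := (stage n w).1.1.
Definition Act1 n w : A := (stage n w).1.2.
Definition Act2 n w : B := (stage n w).2.
Definition sojourn n w : R := ((w.2 n).2)%:num.
Definition H n w : history n := ([tuple stage m w | m < n], X n w).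
Definition T n w : R := \sum_(m < n) sojourn m w.
Definition Tinfty w : \bar R := limn (fun n => (T n w)%:E).

(* Generators of the product sigma-algebra; K and S * A * B are finite and
   discrete, and the factors [0, +oo[ carry the trace of the Borel sets. *)
Definition coordinate_events : set (set path_space) :=
  [set E | exists k, E = kappa @^-1` [set k]] `|`
  [set E | exists n y, E = stage n @^-1` [set y]] `|`
  [set E | exists n (C : set R), measurable C /\ E = sojourn n @^-1` C].

Definition Omega := g_sigma_algebraType coordinate_events.

(* Since kappa and H_n take finitely many values, the two conditional
   probabilities given (kappa, H_n, T_n[, A_n, B_n]) are characterised by
   integrating over the events {kappa = k, H_n = h, T_n \in C[, ...]} with C
   Borel; the right-hand sides are constant on such events. *)
Definition is_law (Q : R -> S -> S -> A -> B -> R) (p : dist R K) (i : S)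
    (pi : policy1) (sigma : policy2) (P : probability Omega R) : Prop :=
  [/\ forall k, P [set w | X 0 w = i /\ kappa w = k] = (p k)%:E,
      forall n k (h : history n) a b (C : set R), measurable C ->
        P [set w | [/\ kappa w = k, H n w = h, C (T n w),
                       Act1 n w = a & Act2 n w = b]] =
        ((pi k n h a * sigma n h b)%:E *
         P [set w | [/\ kappa w = k, H n w = h & C (T n w)]])%E
    & forall n k (h : history n) a b (t : R) j (C : set R),
        0 <= t -> measurable C ->
        P ([set w | [/\ kappa w = k, H n w = h, C (T n w),
                        Act1 n w = a & Act2 n w = b]] `&`
           [set w | T n.+1 w - T n w <= t /\ X n.+1 w = j]) =
        ((Q t j h.2 a b)%:E *
         P [set w | [/\ kappa w = k, H n w = h, C (T n w),
                        Act1 n w = a & Act2 n w = b]])%E].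

(* The n with T_n <= t < T_{n+1}; it exists and is unique for
   0 <= t < T_infty. *)
Definition epoch (t : R) w : nat := get [set n | T n w <= t < T n.+1 w].

Definition Xt t w : S := X (epoch t w) w.
Definition At t w : A := Act1 (epoch t w) w.
Definition Bt t w : B := Act2 (epoch t w) w.

Section DualGame.
Variables (c : K -> S -> A -> B -> R) (alpha : R).
(* [P p i pi sigma] is the measure P_{p,i}^{pi,sigma}. *)
Variable P : dist R K -> S -> policy1 -> policy2 -> probability Omega R.
Variable z : K -> R.

Local Open Scope ereal_scope.

Definition dual_payoff (i : S) (rp : dual_policy1) (sigma : policy2) : \bar R :=
  \int[P (rp.1 i) i rp.2 sigma]_w
    \int[@lebesgue_measure R]_(t in [set t : R | (0 <= t)%R /\ t%:E < Tinfty w])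
      (expR (- (alpha * t)) *
       (c (kappa w) (Xt t w) (At t w) (Bt t w) - z (kappa w)))%:E.

Definition lower_value (i : S) : \bar R :=
  ereal_sup (range (fun rp => ereal_inf (range (dual_payoff i rp)))).

Definition upper_value (i : S) : \bar R :=
  ereal_inf (range (fun sigma =>
    ereal_sup (range (fun rp => dual_payoff i rp sigma)))).

Definition is_value (i : S) (v : \bar R) : Prop :=
  lower_value i = v /\ upper_value i = v.

Definition optimal2 (sigma : policy2) : Prop :=
  forall i, ereal_sup (range (fun rp => dual_payoff i rp sigma)) <=
            upper_value i.

End DualGame.
End Game.

(* Main.v *)
(** Compactness of Player 2's policies replaces the minimax argument.  For a
    fixed initial state and a fixed policy of Player 1, the payoff is continuous
    in sigma for pointwise convergence: up to [M / alpha * r ^ N], uniformly in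
    sigma, it is a polynomial in the finitely many numbers [sigma_n(b | h)],
    n < N.  The error bound holds because [E exp(- alpha T_N) <= r ^ N] with
    [r < 1], and the coefficients of the polynomial are products of transforms
    [q(j | i, a, b) = int_0^oo alpha exp(- alpha u) Q(u, j | i, a, b) du].
    Take for each i a sequence of policies minimising the worst-case payoff from
    i, let history h follow the sequence of its own initial state, and pass to
    the limit along one ultrafilter on the naturals. *)

Require Import Defs.
From mathcomp Require Import measurable_realfun lra.

Set Implicit Arguments.
Unset Strict Implicit.
Unset Printing Implicit Defensive.

Import Order.TTheory GRing.Theory Num.Theory.
Import numFieldNormedType.Exports.

Local Open Scope classical_set_scope.
Local Open Scope ring_scope.

(** * Integrals and the exponential law *)

(* Spares us the measurability of the two integrands of [dual_payoff]. *)
Lemma le_integral_nomeas d (T : measurableType d) (R : realType)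
    (mu : {measure set T -> \bar R}) (D : set T)
    (f g : T -> \bar R) :
  (forall x, D x -> f x <= g x)%E ->
  (\int[mu]_(x in D) f x <= \int[mu]_(x in D) g x)%E.
Proof.
(* For nonnegative functions the integral is a supremum over the simple functions below, which is
   monotone whether or not the function is measurable. The general case splits into positive and
   negative parts. *)
have ge0_le (u v : T -> \bar R) : (forall x, D x -> 0 <= u x)%E ->
    (forall x, D x -> u x <= v x)%E ->
    (\int[mu]_(x in D) u x <= \int[mu]_(x in D) v x)%E.
  move=> u0 uv; rewrite !ge0_integralE//; last first.
    by move=> x Dx; rewrite (le_trans (u0 _ Dx))// uv.
  apply: ereal_sup_le => _ [h hu <-]; exists h => // x.
  by apply: (le_trans (hu x)); apply: lee_restrict.
move=> fg; rewrite integralE [leRHS]integralE leeB//.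
- apply: ge0_le => // x /mem_set Dx.
  by apply: (funepos_le (D := D)) => // y; rewrite inE => /fg.
- apply: ge0_le => // x /mem_set Dx.
  by apply: (funeneg_le (D := D)) => // y; rewrite inE => /fg.
Qed.

Lemma integral_exp_tail (R : realType) (alpha a : R) : 0 < alpha -> 0 <= a ->
  (\int[lebesgue_measure]_(t in `[a, +oo[) (alpha * expR (- (alpha * t)))%:E =
   (expR (- (alpha * a)))%:E)%E.
Proof.
move=> alpha0 a0.
have cexp : continuous (fun z : R^o => expR (- (alpha * z))).
  move=> z; apply: continuous_comp; last exact: continuous_expR.
  by apply: (@continuousN _ R^o); exact: mulrl_continuous.
rewrite (@ge0_continuous_FTC2y _ _ (fun x => - expR (- (alpha * x))) _ 0)//.
- by rewrite EFinN oppeK add0e.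
- by move=> x ax; rewrite mulr_ge0 ?expR_ge0 // ltW.
- apply: continuous_subspaceT => x.
  have H := cvgM (cvg_cst alpha) (cexp x); exact: H.
- rewrite -oppr0; apply: cvgN.
  apply: (@cvg_comp _ _ _ (fun x => alpha * x) (fun z => expR (- z)) _
    (pinfty_nbhs R)); last exact: cvgr_expR.
  exact: gt0_cvgMry.
- by apply: cvgN; apply/cvg_at_right_filter; exact: cexp.
- move=> z _; rewrite derive1_comp// derive1N// derive1_id mulN1r.
  rewrite derive1_comp// !derive1E.
  have /funeqP -> := @derive_expR R.
  rewrite deriveN// -derive1E derive1Ml// derive1_id mulr1 mulrN opprK.
  by rewrite mulrC.
Qed.

(** Allows exp(- alpha y) to be read as the chance that an exponential time is at least y. Means of
    discount factors then reduce to the distribution functions that [is_law] prescribes. *)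
Lemma exponential_law (R : realType) (alpha : R) : 0 < alpha ->
  exists nu : probability (measurableTypeR R) R,
    forall a, 0 <= a -> nu `[a, +oo[%classic = (expR (- (alpha * a)))%:E.
Proof.
move=> alpha0.
have [m mE] : exists m : probability (measurableTypeR R) R,
    forall V, m V = exponential_prob alpha V.
  by eexists [the probability _ _ of exponential_prob alpha].
exists m => a a0; rewrite mE /exponential_prob -integral_exp_tail//.
apply: eq_integral => x; rewrite inE/= in_itv/= andbT => ax.
by rewrite exponential_pdfE ?(le_trans a0)// mulNr.
Unshelve. all: exact: alpha0.
Qed.

(** * Discount factors as exponential tails *)

Section Laplace.
Context d (T : measurableType d) (R : realType).
Variables (P : probability T R) (nu : probability (measurableTypeR R) R).
Variables (phi : R -> R).
Hypothesis nu_tail : forall a, 0 <= a -> nu `[a, +oo[%classic = (phi a)%:E.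
Implicit Types (E : set T) (f Y : T -> R).

Definition sublevel_integral E f Y (u : R) : \bar R :=
  (\int[P]_(w in E `&` [set w | (Y w <= u)%R]) (f w)%:E)%E.

(* Tonelli applied to phi(y) = nu{u | y <= u} *)
Lemma layer_cake E f Y : measurable E -> measurable_fun setT f ->
    (forall w, 0 <= f w) -> measurable_fun setT Y -> (forall w, 0 <= Y w) ->
  measurable_fun (`[0, +oo[%classic : set R) (sublevel_integral E f Y) /\
  (\int[P]_(w in E) (f w * phi (Y w))%:E =
   \int[nu]_(u in (`[0%R, +oo[%classic : set R)) sublevel_integral E f Y u)%E.
Proof.
move=> mE mf f0 mY Y0.
pose L := [set p : T * measurableTypeR R | Y p.1 <= p.2].
have mL : measurable L.
  have -> : L = setT `&` [set p : T * measurableTypeR R | Y p.1 <= p.2].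
    by rewrite setTI.
  by apply: measurable_fun_le => //; exact: measurableT_comp.
pose G := fun p : T * measurableTypeR R => (f p.1 * \1_E p.1 * \1_L p)%:E.
have mG : measurable_fun setT G.
  apply/measurable_EFinP; apply: measurable_funM => //.
    apply: measurable_funM; first exact: measurableT_comp.
    apply: (measurableT_comp (f := \1_E : T -> R)) => //.
have G0 p : (0 <= G p)%E by rewrite lee_fin !mulr_ge0.
have GE u : (\int[P]_w G (w, u) = sublevel_integral E f Y u)%E.
  rewrite [RHS]integral_mkcond; apply: eq_integral => w _.
  rewrite /G patchE !indicE/= in_setI.
  have -> : ((w, u) \in L) = (w \in [set w | Y w <= u]) by apply/idP/idP; rewrite !inE.
  by case: (w \in E); case: (w \in _); rewrite /= ?mulr1 ?mulr0 ?mul0r.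
split.
  apply: measurable_funTS.
  have := measurable_fun_fubini_tonelli_G (m1 := P) G mG G0.
  by have -> : fubini_G P G = sublevel_integral E f Y by apply/funext => u; exact: GE.
transitivity (\int[P]_w \int[nu]_u G (w, u))%E.
  rewrite integral_mkcond; apply: eq_integral => w _.
  have -> : (\int[nu]_u G (w, u) = (f w * \1_E w)%:E * nu (`[Y w, +oo[%classic : set R))%E.
    rewrite -[X in (_ * nu X)%E]setIT -integral_indic//.
    rewrite -ge0_integralZl//.
    - apply: eq_integral => u _; rewrite /G EFinM !indicE; congr (_ * (_ : bool)%:R%:E)%E.
      by apply/idP/idP; rewrite !inE/= in_itv/= andbT.
    - by apply/measurable_EFinP.
    - by rewrite lee_fin mulr_ge0.
  rewrite nu_tail// patchE indicE.
  by case: (w \in E); rewrite ?mulr1 ?mulr0 ?mul0e.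
rewrite fubini_tonelli// [RHS]integral_mkcond.
apply: eq_integral => u _; rewrite GE patchE.
case: ifPn => // /negP u0.
(* For u < 0 the sublevel set is empty because Y >= 0, so restricting to the half-line loses
   nothing. *)
rewrite /sublevel_integral [X in integral _ X](_ : _ = set0) ?integral_set0//.
rewrite -subset0 => w [_/= Yu]; apply: u0.
by rewrite inE/= in_itv/= andbT (le_trans _ Yu).
Qed.

End Laplace.

Lemma bounded_integrable d (T : measurableType d) (R : realType)
    (P : probability T R) (E : set T) (f : T -> R) (M : R) :
  measurable E -> measurable_fun setT f -> (forall w, `|f w| <= M) ->
  P.-integrable E (EFin \o f).
Proof.
move=> mE mf fM; apply: measurable_bounded_integrable => //.
- by rewrite (le_lt_trans (probability_le1 _ _)) ?ltry.
- exact: measurable_funTS.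
- exists M; split; first exact: num_real.
  by move=> y My w _; apply: le_trans (fM w) _; rewrite ltW.
Qed.

Lemma bounded_integral_EFin d (T : measurableType d) (R : realType)
    (P : probability T R) (E : set T) (f : T -> R) (M : R) :
  measurable E -> measurable_fun setT f -> (forall w, `|f w| <= M) ->
  (\int[P]_(w in E) (f w)%:E = (\int[P]_(w in E) f w)%R%:E)%E.
Proof.
move=> mE mf fM; rewrite fineK//; apply: integrable_fin_num => //.
exact: (bounded_integrable P mE mf fM).
Qed.

(** * From conditional laws to discounted means *)

Section LaplaceConditioning.
Context d (T : measurableType d) (R : realType).
Variables (P : probability T R) (nu : probability (measurableTypeR R) R).
Variables (alpha : R).
Hypothesis alpha_gt0 : 0 < alpha.
Hypothesis nu_tail : forall a, 0 <= a ->
  nu `[a, +oo[%classic = (expR (- (alpha * a)))%:E.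
Variables (E E' : set T) (Y : T -> R).
Hypothesis (mE : measurable E) (mE' : measurable E').
Hypothesis (mY : measurable_fun setT Y) (Y0 : forall w, 0 <= Y w).

Lemma measurable_expRN : measurable_fun setT (fun w => expR (- (alpha * Y w))).
Proof.
apply: measurableT_comp => //; apply: measurableT_comp => //.
exact: measurable_funM.
Qed.

Lemma expRN_bound w : `|expR (- (alpha * Y w))| <= 1.
Proof.
by rewrite ger0_norm ?expR_ge0// -expR0 ler_expR oppr_le0 mulr_ge0// ltW.
Qed.

(** By [layer_cake] with f = 1, both sides are nu-integrals of the probabilities of sublevel sets,
    and these are proportional level by level. *)
Lemma laplace_scale (c : R) : 0 <= c ->
  (forall u, 0 <= u -> P (E' `&` [set w | Y w <= u]) =
    (c%:E * P (E `&` [set w | (Y w <= u)%R]))%E) ->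
  \int[P]_(w in E') expR (- (alpha * Y w)) =
  c * \int[P]_(w in E) expR (- (alpha * Y w)).
Proof.
move=> c0 EE'; apply: EFin_inj; rewrite EFinM.
have mf := measurable_cst (1 : R) (D := [set: T]).
have mexp := measurable_expRN.
rewrite -!(@bounded_integral_EFin _ _ _ _ _ _ 1) //; try exact: expRN_bound.
have [mF HF] := layer_cake P nu_tail mE mf (fun=> ler01) mY Y0.
have [_ HF'] := layer_cake P nu_tail mE' mf (fun=> ler01) mY Y0.
have one (D : set T) : (\int[P]_(w in D) (expR (- (alpha * Y w)))%:E =
    \int[P]_(w in D) (1 * expR (- (alpha * Y w)))%:E)%E.
  by apply: eq_integral => w _; rewrite mul1r.
rewrite !one HF HF' -ge0_integralZl//; last first.
  by move=> u _; apply: integral_ge0 => w _; rewrite lee_fin.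
have mle u : measurable [set w | Y w <= u].
  by rewrite -[X in measurable X]setTI; exact: measurable_fun_le.
apply: eq_integral => u; rewrite inE/= in_itv/= andbT => u0.
have cstE (D : set T) : measurable D -> (\int[P]_(w in D) 1%:E = P D)%E.
  by move=> mD; rewrite (integral_cst _ mD) mul1e.
by rewrite /sublevel_integral !cstE ?EE'//; exact: measurableI.
Qed.

(** Meant for [Y] the next sojourn time, [f] the discount of the past and [G] the kernel. On each
    layer {Y <= u} the integral of [f] is [G u] times a constant, and the constant leaves the
    integral over [nu]. *)
Lemma laplace_independent (f : T -> R) (G : R -> R) :
  measurable_fun setT f -> (forall w, 0 <= f w <= 1) ->
  measurable_fun (`[0, +oo[%classic : set R) G ->
  (forall u, 0 <= u -> 0 <= G u <= 1) ->
  (forall u, 0 <= u ->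
    \int[P]_(w in E' `&` [set w | Y w <= u]) f w =
    G u * \int[P]_(w in E) f w) ->
  \int[P]_(w in E') (f w * expR (- (alpha * Y w))) =
  \int[nu]_(u in (`[0, +oo[%classic : set R)) G u * \int[P]_(w in E) f w.
Proof.
move=> mf f01 mG G01 EE'.
have f1 w : `|f w| <= 1 by have /andP[? ?] := f01 w; rewrite ger0_norm.
have f0 w : 0 <= f w by have /andP[] := f01 w.
have mexp := measurable_expRN.
have mle u : measurable [set w | Y w <= u].
  by rewrite -[X in measurable X]setTI; exact: measurable_fun_le.
have [_ HF'] := layer_cake P nu_tail mE' mf f0 mY Y0.
apply: EFin_inj; rewrite -(@bounded_integral_EFin _ _ _ _ _ _ 1) //; last 2 first.
- exact: measurable_funM.
- by move=> w; rewrite normrM mulr_ile1 ?expRN_bound.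
have iG : nu.-integrable (`[0, +oo[%classic : set R) (EFin \o G).
  apply: measurable_bounded_integrable => //.
    by rewrite (le_lt_trans (probability_le1 _ _)) ?ltry.
  exists 1; split; first exact: num_real.
  move=> y y1 u; rewrite /= in_itv/= andbT => /G01/andP[G0 G1].
  by rewrite ger0_norm// (le_trans G1)// ltW.
have sE u : 0 <= u ->
    sublevel_integral P E' f Y u = (\int[P]_(w in E) f w * G u)%:E.
  move=> u0; rewrite mulrC -EE'//.
  by rewrite -(@bounded_integral_EFin _ _ _ _ _ _ 1)//; exact: measurableI.
have {}HF' : (\int[P]_(w in E') (f w * expR (- (alpha * Y w)))%:E =
    \int[nu]_(u in (`[0%R, +oo[%classic : set R)) (\int[P]_(w in E) f w * G u)%R%:E)%E.
  by rewrite HF'; apply: eq_integral => u; rewrite inE/= in_itv/= andbT => /sE.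
rewrite HF'; under eq_integral do rewrite EFinM.
rewrite mulrC EFinM integralZl// [X in _ = (_ * X)%E]fineK//.
exact: integrable_fin_num.
Qed.

End LaplaceConditioning.

(** * The law of the embedded process *)

Lemma integrable_sum_EFin d (T : measurableType d) (R : realType)
    (mu : {measure set T -> \bar R}) (D : set T) (I : Type) (s : seq I)
    (f : I -> T -> R) :
  measurable D -> (forall i, mu.-integrable D (EFin \o f i)) ->
  mu.-integrable D (EFin \o (fun x => \sum_(i <- s) f i x)).
Proof.
move=> mD fi; apply: eq_integrable (integrable_sum mD s (P := xpredT) (fun i _ => fi i)) => //.
by move=> x _ /=; rewrite sumEFin.
Qed.

Lemma Rintegral_sum d (T : measurableType d) (R : realType)
    (mu : {measure set T -> \bar R}) (D : set T) (I : Type) (s : seq I)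
    (f : I -> T -> R) :
  measurable D -> (forall i, mu.-integrable D (EFin \o f i)) ->
  \int[mu]_(x in D) (\sum_(i <- s) f i x) =
  \sum_(i <- s) \int[mu]_(x in D) f i x.
Proof.
move=> mD fi; elim: s => [|i s IHs].
  rewrite big_nil /Rintegral integral0_eq// => x _.
  by rewrite big_nil.
rewrite big_cons -IHs -RintegralD//.
  by apply: eq_Rintegral => x _; rewrite big_cons.
exact: integrable_sum_EFin.
Qed.

(** [Z] has finitely many values, so the integrand is the finite sum of its restrictions to the
    level sets of [Z]. *)
Lemma Rintegral_partition d (T : measurableType d) (R : realType)
    (P : probability T R) (D : set T) (I : finType) (Z : T -> I) (phi : I -> R)
    (f : T -> R) (M : R) :
  measurable D -> (forall i, measurable [set w | Z w = i]) ->
  measurable_fun setT f -> (forall w, `|f w| <= M) ->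
  \int[P]_(w in D) (phi (Z w) * f w) =
  \sum_i phi i * \int[P]_(w in D `&` [set w | Z w = i]) f w.
Proof.
move=> mD mZ mf fM.
have fi i : P.-integrable D (EFin \o (f \_ [set w | Z w = i])).
  apply: (@bounded_integrable _ _ _ _ _ _ M) => //.
    by apply/(measurable_restrictT _ (mZ i)); exact: measurable_funTS.
  move=> w; rewrite patchE; case: ifP => // _.
  by rewrite normr0 (le_trans (normr_ge0 _) (fM w)).
transitivity (\int[P]_(w in D) \sum_i (phi i * (f \_ [set w | Z w = i]) w)).
  apply: eq_Rintegral => w _; rewrite (bigD1 (Z w))//= big1 ?addr0 => [|i iZ].
    by rewrite patchE mem_set.
  by rewrite patchE memNset ?mulr0//= => /esym/eqP; rewrite (negbTE iZ).
rewrite Rintegral_sum// => [|i].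
  by apply: eq_bigr => i _; rewrite RintegralZl// Rintegral_mkcondr.
by have := integrableZl mD (phi i) (fi i).
Qed.

Section Measurability.
Variables (R : realType) (K S A B : pointedFinType).
Local Notation Om := (Omega R K S A B).

Lemma measurable_kappa (k : K) : measurable [set w : Om | kappa w = k].
Proof. by apply: sub_sigma_algebra; left; left; exists k. Qed.

Lemma measurable_stage n (D : set (S * A * B)) :
  measurable [set w : Om | D (stage n w)].
Proof.
have -> : [set w : Om | D (stage n w)] =
    \bigcup_(y in D) [set w : Om | stage n w = y].
  by apply/seteqP; split => [w Dw|w [y Dy /= ->]//]; exists (stage n w).
apply: fin_bigcup_measurable; first exact: finite_finset.
move=> y _; apply: sub_sigma_algebra; left; right; by exists n, y.
Qed.

Lemma measurable_sojourn n :
  measurable_fun setT (fun w : Om => sojourn n w).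
Proof.
move=> _ C mC; rewrite setTI.
by apply: sub_sigma_algebra; right; exists n, C.
Qed.

Lemma measurable_T n : measurable_fun setT (fun w : Om => T n w).
Proof. by apply: measurable_sum => m; exact: measurable_sojourn. Qed.

Lemma measurable_H n h : measurable [set w : Om | H n w = h].
Proof.
have -> : [set w : Om | H n w = h] =
    (\bigcap_(m in [set: 'I_n]) [set w : Om | stage m w = tnth h.1 m]) `&`
    [set w : Om | (stage n w).1.1 = h.2].
  apply/seteqP; split => w /=.
    by move=> <-; split => // m _ /=; rewrite tnth_mktuple.
  case: h => h x /= [wh wx]; rewrite /H /X wx; congr (_, _).
  by apply: eq_from_tnth => m; rewrite tnth_mktuple; exact: wh.
apply: measurableI; last exact: (measurable_stage n [set y | y.1.1 = h.2]).
apply: fin_bigcap_measurable; first exact: finite_finset.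
by move=> m _; exact: (measurable_stage m [set tnth h.1 m]).
Qed.

End Measurability.

(** * Transforms of the semi-Markov kernel *)

Section Transform.
Variables (R : realType) (K S A B : pointedFinType).
Variables (Q : R -> S -> S -> A -> B -> R) (hQ : semi_markov_kernel Q).

Lemma kernel01 j i a b u : 0 <= u -> 0 <= Q u j i a b <= 1.
Proof.
case: hQ => h1 h2 _ u0; have Q0 j' : 0 <= Q u j' i a b.
  by case: (h1 j' i a b) => _ _ + _; exact.
rewrite Q0 (le_trans _ (h2 u i a b u0))// (bigD1 j)//= lerDl.
exact: sumr_ge0.
Qed.

Lemma measurable_kernel j i a b :
  measurable_fun (`[0, +oo[%classic : set R) (fun u => Q u j i a b).
Proof.
case: hQ => h1 _ _; have [Qmono _ _ _] := h1 j i a b.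
(* Q is controlled at nonnegative times only; composing with max(0, u) gives a function monotone on
   the whole line. *)
have mQ : measurable_fun (`[0, +oo[%classic : set R)
    (fun u => Q (Num.max 0 u) j i a b).
  apply: nondecreasing_measurable => // s t st.
  by apply: Qmono; [rewrite le_max lexx|rewrite ge_max !le_max lexx st orbT].
apply: eq_measurable_fun mQ => u.
by rewrite inE/= in_itv/= andbT => /max_r ->.
Qed.

Variables (alpha : R) (nu : probability (measurableTypeR R) R).
Hypothesis alpha_gt0 : 0 < alpha.
Hypothesis nu_tail : forall a, 0 <= a ->
  nu `[a, +oo[%classic = (expR (- (alpha * a)))%:E.

(** For [nu] exponential this is, by Tonelli, the Laplace-Stieltjes transform of Q(., j | i, a, b):
    the mean of exp(- alpha tau) over a sojourn tau ending with a jump to j. *)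
Definition kernel_transform j i a b : R :=
  \int[nu]_(u in (`[0, +oo[%classic : set R)) Q u j i a b.

Lemma integrable_half_line (f : R -> R) (M : R) :
  measurable_fun (`[0, +oo[%classic : set R) f ->
  (forall u, 0 <= u -> `|f u| <= M) ->
  nu.-integrable (`[0, +oo[%classic : set R) (EFin \o f).
Proof.
move=> mf fM; apply: measurable_bounded_integrable => //.
  by rewrite (le_lt_trans (probability_le1 _ _)) ?ltry.
exists M; split; first exact: num_real.
move=> y My u; rewrite /= in_itv/= andbT => u0.
by rewrite (le_trans (fM u u0))// ltW.
Qed.

Variables (delta epsilon : R).
Hypothesis (hdelta : 0 < delta) (hepsilon : 0 < epsilon < 1).
Hypothesis hD : forall i a b, sojourn_cdf Q delta i a b <= 1 - epsilon.

(* Comes from D(u) <= 1 - epsilon + epsilon * 1_{u >= delta}. *)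
Definition contraction : R := 1 - epsilon + epsilon * expR (- (alpha * delta)).

Lemma contraction_bounds : 0 <= contraction < 1.
Proof.
have /andP[e0 e1] := hepsilon; apply/andP; split.
  by rewrite addr_ge0 ?subr_ge0 ?(ltW e1)// mulr_ge0 ?expR_ge0// ltW.
rewrite /contraction -addrA gtrDl addrC subr_lt0 gtr_pMr//.
by rewrite -expR0 ltr_expR oppr_lt0 mulr_gt0.
Qed.

(** Each sojourn shrinks the mean discount by at least this factor; [mean_discount_le] iterates the
    bound. *)
Lemma sum_kernel_transform i a b :
  \sum_j kernel_transform j i a b <= contraction.
Proof.
have /andP[e0 e1] := hepsilon.
have Q1 j u : 0 <= u -> `|Q u j i a b| <= 1.
  by move=> /(kernel01 j i a b)/andP[? ?]; rewrite ger0_norm.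
have Qi j : nu.-integrable (`[0, +oo[%classic : set R)
    (EFin \o (fun u => Q u j i a b)).
  apply: (integrable_half_line (M := 1)); first exact: measurable_kernel.
  exact: Q1.
have -> : \sum_j kernel_transform j i a b =
    \int[nu]_(u in (`[0, +oo[%classic : set R)) \sum_j Q u j i a b.
  by rewrite Rintegral_sum.
have mR : measurable (`[0%R, +oo[%classic : set (measurableTypeR R)) by [].
pose ind := (\1_(`[delta, +oo[%classic : set R) : R -> R).
have mind : measurable_fun (`[0, +oo[%classic : set R) ind.
  by apply: measurable_funTS; exact: measurable_indic.
have iind : nu.-integrable (`[0, +oo[%classic : set R) (EFin \o ind).
  apply: (integrable_half_line (M := 1)) => // u _.
  by rewrite /ind indicE; case: (_ \in _); rewrite ?normr1 ?normr0.
have icst (c : R) : nu.-integrable (`[0, +oo[%classic : set R) (EFin \o cst c).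
  by apply: (integrable_half_line (M := `|c|)).
have iei : nu.-integrable (`[0, +oo[%classic : set R)
    (EFin \o (fun u => epsilon * ind u)).
  by have := integrableZl mR epsilon iind.
apply: (@le_trans _ _
  (\int[nu]_(u in (`[0, +oo[%classic : set R)) (1 - epsilon + epsilon * ind u))).
  apply: le_Rintegral => //.
  - exact: integrable_sum_EFin.
  - have := integrableD mR (icst (1 - epsilon)) iei.
    by apply: eq_integrable.
  - move=> u; rewrite /= in_itv/= andbT => u0.
    (* From delta on, D(u) <= 1; before delta, monotonicity of Q compares D(u) with D(delta). *)
    case: hQ => h1 h2 _; rewrite /ind indicE; case: (leP delta u) => du.
      rewrite mem_set/= ?in_itv/= ?du// mulr1 subrK; exact: h2.
    rewrite memNset/= ?mulr0 ?addr0; last by rewrite in_itv/= andbT leNgt du.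
    apply: le_trans (hD i a b); apply: ler_sum => j _.
    by case: (h1 j i a b) => + _ _ _; apply => //; exact: ltW.
rewrite RintegralD//.
have -> : \int[nu]_(u in (`[0, +oo[%classic : set R)) (epsilon * ind u) =
    epsilon * \int[nu]_(u in (`[0, +oo[%classic : set R)) ind u.
  by rewrite RintegralZl.
rewrite Rintegral_cst// lerD//.
  rewrite ler_piMr ?subr_ge0 ?(ltW e1)//.
  rewrite (_ : fine _ = fine (expR (- (alpha * 0)))%:E); last first.
    by congr fine; exact: nu_tail.
  by rewrite /= mulr0 oppr0 expR0.
rewrite ler_pM2l// /Rintegral integral_indic//.
have -> : (`[delta, +oo[%classic : set R) `&` `[0, +oo[ = `[delta, +oo[%classic.
  apply/setIidl => u; rewrite /= !in_itv/= !andbT => /(le_trans _); apply.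
  exact: ltW.
rewrite (_ : fine _ = fine (expR (- (alpha * delta)))%:E)//.
  by congr fine; apply: nu_tail; exact: ltW.
exact: icst.
Qed.

End Transform.

(** * Closed form of the discounted weight of a history *)

Section Weights.
Variables (R : realType) (K S A B : pointedFinType).

Definition last_stage n (h : history S A B n.+1) : S * A * B := tnth h.1 ord_max.

Definition prev n (h : history S A B n.+1) : history S A B n :=
  ([tuple tnth h.1 (widen_ord (leqnSn n) m) | m < n], (last_stage h).1.1).

(** Defined by the same recursion on prefixes as [weight], which makes [weight_start] a plain
    induction. *)
Fixpoint start n : history S A B n -> S :=
  match n with
  | 0 => fun h => h.2
  | m.+1 => fun h => start (prev h)
  end.

Variables (Q : R -> S -> S -> A -> B -> R).
Variable (nu : probability (measurableTypeR R) R).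

(** This is the mean of exp(- alpha T_n) over {kappa = k, H_n = h}, as [before_transform] shows. The
    closed form exhibits it as a constant times a product of values of [sigma] at the prefixes of
    [h]. *)
Fixpoint weight (p : dist R K) (i : S) (pi : policy1 R K S A B)
    (sigma : policy2 R S A B) (k : K) n : history S A B n -> R :=
  match n with
  | 0 => fun h => if h.2 == i then p k else 0
  | m.+1 => fun h =>
      let a := (last_stage h).1.2 in let b := (last_stage h).2 in
      kernel_transform Q nu h.2 (prev h).2 a b *
      (pi k m (prev h) a * sigma m (prev h) b * weight p i pi sigma k (prev h))
  end.

(** The initial factor vanishes for every [sigma]. Hence from state i only the behaviour on
    histories starting at i counts, and one policy can be assembled from a separate choice for each
    initial state. *)
Lemma weight_start p i pi sigma k n (h : history S A B n) :
  start h != i -> weight p i pi sigma k h = 0.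
Proof.
elim: n h => [|n IHn] h /= hi; first by rewrite (negbTE hi).
by rewrite IHn// !mulr0.
Qed.

Lemma H_succ n (w : path_space R K S A B) h :
  H n.+1 w = h <->
  [/\ H n w = prev h, Act1 n w = (last_stage h).1.2,
      Act2 n w = (last_stage h).2 & X n.+1 w = h.2].
Proof.
split=> [<-|].
  rewrite /last_stage /prev /last_stage/= tnth_mktuple; split => //.
  congr (_, _).
  by apply: eq_from_tnth => m; rewrite !tnth_mktuple.
case: h => h x [Hw aw bw xw]; rewrite /H xw; congr (_, _).
have hw := congr1 fst Hw; have {Hw}Xw := congr1 snd Hw.
apply: eq_from_tnth => m; rewrite tnth_mktuple.
have [mn|mn] := ltnP m n.
  have {}hw := congr1 (fun t => tnth t (Ordinal mn)) hw.
  rewrite !tnth_mktuple in hw; rewrite hw;congr (tnth _ _); exact: val_inj.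
have -> : m = ord_max.
  by apply: val_inj => /=; apply/eqP; rewrite eqn_leq mn -ltnS ltn_ord.
move: Xw aw bw; rewrite /H /prev /X /Act1 /Act2 /last_stage/=.
by case: (stage n w) (tnth h ord_max) => [[? ?] ?] [[? ?] ?]/= -> -> ->.
Qed.

End Weights.

(** * Discounted means under the law of the game *)

Section Law.
Variables (R : realType) (K S A B : pointedFinType).
Local Notation Om := (Omega R K S A B).
Variables (Q : R -> S -> S -> A -> B -> R) (hQ : semi_markov_kernel Q).
Variables (alpha : R) (nu : probability (measurableTypeR R) R).
Hypothesis alpha_gt0 : 0 < alpha.
Hypothesis nu_tail : forall a, 0 <= a ->
  nu `[a, +oo[%classic = (expR (- (alpha * a)))%:E.
Variables (p : dist R K) (i : S) (pi : policy1 R K S A B).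
Variables (sigma : policy2 R S A B) (P : probability Om R).
Hypothesis law : is_law Q p i pi sigma P.

Definition discount n (w : Om) : R := expR (- (alpha * T n w)).

Lemma sojourn_ge0 n (w : Om) : 0 <= sojourn n w.
Proof. by rewrite /sojourn. Qed.

Lemma T_ge0 n (w : Om) : 0 <= T n w.
Proof. by apply: sumr_ge0 => m _; exact: sojourn_ge0. Qed.

Lemma T_succ n (w : Om) : T n.+1 w = T n w + sojourn n w.
Proof. by rewrite /T big_ord_recr. Qed.

Lemma measurable_discount n : measurable_fun setT (discount n).
Proof. by apply: measurable_expRN; exact: measurable_T. Qed.

Lemma discount_bound n w : `|discount n w| <= 1.
Proof. by apply: expRN_bound => //; exact: T_ge0. Qed.

Definition before_event n k (h : history S A B n) : set Om :=
  [set w | kappa w = k /\ H n w = h].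

(** Written as a level set of a single finite-valued map, the form that [Rintegral_partition]
    takes. *)
Definition stage_event n (z : K * history S A B n * A * B) : set Om :=
  [set w | (kappa w, H n w, Act1 n w, Act2 n w) = z].

Lemma measurable_before n k (h : history S A B n) : measurable (before_event k h).
Proof. by apply: measurableI; [exact: measurable_kappa|exact: measurable_H]. Qed.

Lemma stage_eventE n k (h : history S A B n) a b :
  stage_event (k, h, a, b) =
  before_event k h `&` [set w | (stage n w).1.2 = a /\ (stage n w).2 = b].
Proof.
by apply/seteqP; split => w; [case=> <- <- <- <-|case=> -[<- <-] [<- <-]].
Qed.

Lemma measurable_stage_event n (z : K * history S A B n * A * B) :
  measurable (stage_event z).
Proof.
case: z => [[[k h] a] b]; rewrite stage_eventE.
apply: measurableI; first exact: measurable_before.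
exact: (measurable_stage n [set y | y.1.2 = a /\ y.2 = b]).
Qed.

Definition state_event n (j : S) : set Om := [set w | X n w = j].

Lemma measurable_state_event n j : measurable (state_event n j).
Proof. exact: (measurable_stage n [set y | y.1.1 = j]). Qed.

Lemma measurable_ray (C : R) : measurable [set t : R | t <= C].
Proof.
have -> : [set t : R | t <= C] = `]-oo, C]%classic by [].
exact: measurable_itv.
Qed.

(** The action probabilities given (kappa, H_n, T_n) do not depend on T_n. The second clause of
    [is_law], with C a ray ]-oo, u], thus scales every sublevel set of T_n by the same constant. *)
Lemma stage_transform n k (h : history S A B n) a b :
  \int[P]_(w in stage_event (k, h, a, b)) discount n w =
  pi k h a * sigma h b * \int[P]_(w in before_event k h) discount n w.
Proof.
apply: (laplace_scale alpha_gt0 nu_tail).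
- exact: measurable_before.
- exact: measurable_stage_event.
- exact: measurable_T.
- exact: T_ge0.
- by rewrite mulr_ge0 ?mass_ge0.
move=> u _; case: law => _ + _.
move=> /(_ n k h a b [set t | t <= u] (measurable_ray u)) /=.
rewrite stage_eventE => E.
rewrite (_ : before_event k h `&` [set w | T n w <= u] =
  [set w | [/\ kappa w = k, H n w = h & T n w <= u]]); last first.
  by apply/seteqP; split => w; [case=> -[]|case=> ? ? ?; split].
rewrite -E; congr (P _); apply/seteqP; split => w.
  by case=> -[[? ?] [? ?]] ?; split.
by case=> ? ? ? ? ?; split.
Qed.

(** The discount at T_{n+1} is that at T_n times the discount over the sojourn.
    [laplace_independent] handles the sojourn, and its hypothesis at a fixed u is a scaling
    statement about T_n. *)
Lemma next_transform n k (h : history S A B n) a b j :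
  \int[P]_(w in stage_event (k, h, a, b) `&` state_event n.+1 j)
    discount n.+1 w =
  kernel_transform Q nu j h.2 a b *
  \int[P]_(w in stage_event (k, h, a, b)) discount n w.
Proof.
transitivity (\int[P]_(w in stage_event (k, h, a, b) `&` state_event n.+1 j)
    (discount n w * expR (- (alpha * sojourn n w)))).
  apply: eq_Rintegral => w _.
  by rewrite /discount T_succ mulrDr opprD expRD.
have mE := measurable_stage_event (k, h, a, b).
have mE' : measurable (stage_event (k, h, a, b) `&` state_event n.+1 j).
  by apply: measurableI => //; exact: measurable_state_event.
have ms u : measurable [set w : Om | sojourn n w <= u].
  rewrite -[X in measurable X]setTI; apply: measurable_fun_le => //.
  exact: measurable_sojourn.
apply: (laplace_independent alpha_gt0 nu_tail) => //.
- exact: measurable_sojourn.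
- exact: sojourn_ge0.
- exact: measurable_discount.
- move=> w; rewrite expR_ge0/=; have := discount_bound n w.
  by rewrite ger0_norm ?expR_ge0.
- exact: measurable_kernel.
- by move=> u; exact: kernel01.
(* With the sojourn bounded by u, the third clause of [is_law] on rays in T_n gives the constant
   Q(u, j | h.2, a, b). *)
move=> u u0; apply: (laplace_scale alpha_gt0 nu_tail) => //.
- exact: measurableI.
- exact: measurable_T.
- exact: T_ge0.
- by have /andP[] := kernel01 hQ j h.2 a b u0.
move=> v _; case: law => _ _.
move=> /(_ n k h a b u j [set t | t <= v] u0 (measurable_ray v)) /= E.
rewrite (_ : stage_event (k, h, a, b) `&` [set w | T n w <= v] =
  [set w | [/\ kappa w = k, H n w = h, T n w <= v, Act1 n w = a
    & Act2 n w = b]]); last first.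
  rewrite stage_eventE; apply/seteqP; split => w.
    by case=> -[[? ?] [? ?]] ?; split.
  by case=> ? ? ? ? ?; split.
rewrite -E; congr (P _); rewrite stage_eventE; apply/seteqP; split => w.
  case=> -[[[[? ?] [? ?]] ?] /= su] ?; split; first by split.
  by rewrite /= T_succ addrC addKr.
by case=> -[? ? ? ? ?] [/=]; rewrite T_succ addrC addKr => ? ?; split.
Qed.

(** Induction on n: a longer history is its prefix, then an action pair, then a jump, whose factors
    come from [stage_transform] and [next_transform]. *)
Lemma before_transform n k (h : history S A B n) :
  \int[P]_(w in before_event k h) discount n w = weight Q nu p i pi sigma k h.
Proof.
elim: n h => [|n IHn] h.
  transitivity (\int[P]_(w in before_event k h) 1).
    by apply: eq_Rintegral => w _; rewrite /discount /T big_ord0 mulr0 oppr0 expR0.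
  rewrite Rintegral_cst ?mul1r; last exact: measurable_before.
  have beforeE j : [set w : Om | X 0 w = j /\ kappa w = k] = before_event k ([tuple], j).
    apply/seteqP; split => w; case.
      by move=> <- ?; split => //; rewrite /H; congr (_, _); rewrite tuple0.
    by move=> ? [].
  have hE : h = ([tuple], h.2) by case: h => h x; rewrite (tuple0 h).
  case: law => h0 _ _ /=; case: eqVneq => [hi|hi].
    by rewrite hE hi -beforeE h0.
  (* The first clause of [is_law] speaks of the state i alone. Summing it over the types gives P(X_0
     = i) = 1, so a history starting elsewhere is null. *)
  suff -> : P (before_event k h) = 0%E by [].
  have mi : measurable (state_event 0 i) by exact: measurable_state_event.
  have Pi : P (state_event 0 i) = 1%E.
    rewrite -[LHS]fineK ?fin_num_measure//; congr EFin.
    rewrite -[LHS]mul1r -Rintegral_cst// -[RHS](mass_sum1 p).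
    have := @Rintegral_partition _ _ _ P _ _ (fun w : Om => kappa w) (fun=> 1)
      (fun=> 1) 1 mi (@measurable_kappa R K S A B) (measurable_cst _).
    rewrite normr1 => /(_ (fun=> lexx _)).
    move=> H; apply: etrans (etrans _ H) _.
      by apply: eq_Rintegral => w _; rewrite mulr1.
    apply: eq_bigr => k' _; rewrite mul1r Rintegral_cst ?mul1r.
      exact: (congr1 fine (h0 k')).
    by apply: measurableI => //; exact: measurable_kappa.
  apply/eqP; rewrite eq_le measure_ge0 andbT.
  have <- : P (~` state_event 0 i) = 0%E by rewrite probability_setC// Pi subee.
  apply: le_measure; rewrite ?inE.
  - exact: measurable_before.
  - exact: measurableC.
  by move=> w [_ wh]; rewrite /= /state_event/= => wi; case/eqP: hi; rewrite -wh.
transitivity (kernel_transform Q nu h.2 (prev h).2 (last_stage h).1.2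
    (last_stage h).2 * \int[P]_(w in stage_event (k, prev h, (last_stage h).1.2,
    (last_stage h).2)) discount n w); last by rewrite stage_transform IHn.
rewrite -next_transform; congr Rintegral.
rewrite stage_eventE; apply/seteqP; split => w.
  by case=> ? /H_succ[]; split.
by case=> -[[? ?] [? ?]] ?; split => //; apply/H_succ; split.
Qed.

(** Closed form of the mean of exp(- alpha T_n) over [stage_event z]. *)
Definition stage_weight n (z : K * history S A B n * A * B) : R :=
  pi z.1.1.1 z.1.1.2 z.1.2 * sigma z.1.1.2 z.2 *
  weight Q nu p i pi sigma z.1.1.1 z.1.1.2.

(** Mean discount over the sojourn that begins at stage [z], whatever the next state. *)
Definition total_transform n (z : K * history S A B n * A * B) : R :=
  \sum_j kernel_transform Q nu j z.1.1.2.2 z.1.2 z.2.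

Lemma stage_weightE n (z : K * history S A B n * A * B) :
  \int[P]_(w in stage_event z) discount n w = stage_weight z.
Proof. by case: z => [[[k h] a] b]; rewrite stage_transform before_transform. Qed.

Lemma stage_discount_succ n (z : K * history S A B n * A * B) :
  \int[P]_(w in stage_event z) discount n.+1 w =
  total_transform z * stage_weight z.
Proof.
rewrite -stage_weightE; have mz := measurable_stage_event z.
have := Rintegral_partition P (fun=> 1) mz (@measurable_state_event n.+1)
  (measurable_discount n.+1) (@discount_bound n.+1).
under eq_Rintegral do rewrite mul1r.
move=> ->; rewrite mulr_suml; apply: eq_bigr => j _; rewrite mul1r.
by case: z mz => [[[k h] a] b] mz; rewrite next_transform.
Qed.

(** The indices n and m are separate because the payoff of stage n involves the discounts at both
    T_n and T_{n+1}. *)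
Lemma stage_partition (phi : K -> S * A * B -> R) n m :
  \int[P]_w (phi (kappa w) (stage n w) * discount m w) =
  \sum_(z : K * history S A B n * A * B)
    phi z.1.1.1 (z.1.1.2.2, z.1.2, z.2) *
    \int[P]_(w in stage_event z) discount m w.
Proof.
have := Rintegral_partition P
  (fun z : K * history S A B n * A * B => phi z.1.1.1 (z.1.1.2.2, z.1.2, z.2))
  measurableT (@measurable_stage_event n) (measurable_discount m)
  (@discount_bound m).
under eq_bigr do rewrite setTI.
move=> <-; apply: eq_Rintegral => w _ /=; congr (phi _ _ * _).
by rewrite /X /Act1 /Act2; case: (stage n w) => [[? ?] ?].
Qed.

End Law.

(** * Payoffs *)

Section Pathwise.
Variables (R : realType) (K S A B : pointedFinType).
Local Notation Om := (Omega R K S A B).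
Variables (c : K -> S -> A -> B -> R) (alpha : R) (alpha_gt0 : 0 < alpha).
Variable z : K -> R.

Definition rate (k : K) (y : S * A * B) : R := c k y.1.1 y.1.2 y.2 - z k.

(** A sum instead of a maximum: any common bound of the rates serves. *)
Definition rate_bound : R := \sum_k \sum_y `|rate k y|.

Lemma rate_le k y : `|rate k y| <= rate_bound.
Proof.
rewrite /rate_bound (bigD1 k)//= (bigD1 y)//= -addrA lerDl.
by rewrite addr_ge0// sumr_ge0// => *; rewrite ?sumr_ge0.
Qed.

Lemma rate_bound_ge0 : 0 <= rate_bound.
Proof. by rewrite sumr_ge0// => k _; rewrite sumr_ge0. Qed.

(** The payoff collected before T_N: the rate is constant on [T_n, T_{n+1}[, where exp(- alpha t)
    integrates to the difference of the discounts divided by alpha. *)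
Definition partial_payoff N (w : Om) : R :=
  alpha^-1 * \sum_(n < N) rate (kappa w) (stage n w) *
    (discount alpha n w - discount alpha n.+1 w).

Definition path_payoff (w : Om) : \bar R :=
  (\int[@lebesgue_measure R]_(t in [set t : R | (0 <= t)%R /\ t%:E < Tinfty w])
      (expR (- (alpha * t)) *
       (c (kappa w) (Xt t w) (At t w) (Bt t w) - z (kappa w)))%:E)%E.

Lemma T_nondecreasing (w : Om) : {homo (fun n => T n w) : m n / (m <= n)%N >-> m <= n}.
Proof.
apply: homo_leq => //; first exact: le_trans.
by move=> n; rewrite T_succ lerDl; exact: sojourn_ge0.
Qed.

Lemma TinftyE (w : Om) : Tinfty w = ereal_sup (range (fun n => (T n w)%:E)).
Proof.
apply/cvg_lim => //; apply: ereal_nondecreasing_cvgn => m n mn.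
by rewrite lee_fin; exact: T_nondecreasing.
Qed.

(** [epoch] is a choice, so its defining set needs an element: the predecessor of the least m with t
    < T_m. Such an m exists because t < T_infty, and m > 0 because T_0 = 0 <= t. *)
Lemma epochP (w : Om) (t : R) : 0 <= t -> (t%:E < Tinfty w)%E ->
  T (epoch t w) w <= t < T (epoch t w).+1 w.
Proof.
move=> t0; rewrite TinftyE => /ereal_sup_gt[_ [n _ <-]]; rewrite lte_fin => tn.
have exT : exists n, t < T n w by exists n.
have [m tm min_m] := ex_minnP exT.
case: m tm min_m => [|m] tm min_m.
  by move: tm; rewrite /T big_ord0 ltNge t0.
suff : [set n | T n w <= t < T n.+1 w] (epoch t w) by [].
apply: getI (m : _) _; rewrite /= tm andbT leNgt; apply/negP => /min_m.
by rewrite ltnn.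
Qed.

Lemma reached_epoch (w : Om) (t : R) n : 0 <= t -> (t%:E < Tinfty w)%E ->
  (T n w <= t) = (n <= epoch t w)%N.
Proof.
move=> t0 tT; have /andP[Te eT] := epochP t0 tT; apply/idP/idP => [Tn|ne].
  rewrite leqNgt; apply/negP => /(T_nondecreasing w) /(lt_le_trans eT).
  by rewrite ltNge Tn.
exact: le_trans (T_nondecreasing w ne) Te.
Qed.

Let e (t : R) : R := alpha * expR (- (alpha * t)).

(** The difference of consecutive tails is the exponential density on [T_n, T_{n+1}[, and each tail
    integrates to a discount factor. *)
Let tail (w : Om) n : R -> R := e \_ (`[T n w, +oo[%classic : set R).

Let tailE w n t : tail w n t = e t * (T n w <= t)%R%:R.
Proof.
rewrite /tail patchE; case: ifPn => [|/negP].
  by rewrite inE/= in_itv/= andbT => ->; rewrite mulr1.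
by rewrite inE/= in_itv/= andbT => /negP/negbTE ->; rewrite mulr0.
Qed.

Let measurable_e : measurable_fun setT e.
Proof.
apply: measurable_funM => //; apply: measurableT_comp => //.
by apply: measurableT_comp => //; exact: measurable_funM.
Qed.

Let integral_tail w n :
  (\int[@lebesgue_measure R]_t (tail w n t)%:E = (discount alpha n w)%:E)%E.
Proof.
rewrite /discount -integral_exp_tail//; last exact: T_ge0.
rewrite [RHS]integral_mkcond; apply: eq_integral => t _.
by rewrite /tail restrict_EFin.
Qed.

Let integrable_tail w n :
  (@lebesgue_measure R).-integrable setT (EFin \o tail w n).
Proof.
apply/integrableP; split.
  apply/measurable_EFinP.
  by apply/(measurable_restrictT _ (measurable_itv _)); exact: measurable_funTS.
rewrite (_ : (fun x => _) = (fun t => (tail w n t)%:E)).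
  by rewrite integral_tail ltry.
apply/funext => t /=; rewrite ger0_norm// tailE mulr_ge0//.
by rewrite mulr_ge0 ?expR_ge0// ltW.
Qed.

(** For s = 1 and s = -1 these are a majorant and a minorant of the payoff integrand: exact before
    T_N, with rate s times [rate_bound] from T_N on. *)
Let step (w : Om) N s t : R := alpha^-1 *
  (\sum_(n < N) rate (kappa w) (stage n w) * (tail w n t - tail w n.+1 t)
   + s * rate_bound * tail w N t).

Let integral_step w N s :
  (\int[@lebesgue_measure R]_t (step w N s t)%:E =
   (partial_payoff N w + s * (rate_bound / alpha * discount alpha N w))%:E)%E.
Proof.
have tailR n : \int[@lebesgue_measure R]_t tail w n t = discount alpha n w.
  by rewrite /Rintegral integral_tail.
have id n : (@lebesgue_measure R).-integrable setT
    (EFin \o (fun t => rate (kappa w) (stage n w) * (tail w n t - tail w n.+1 t))).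
  have := integrableZl measurableT (rate (kappa w) (stage n w))
    (integrableB measurableT (integrable_tail w n) (integrable_tail w n.+1)).
  by apply: eq_integrable.
have isum : (@lebesgue_measure R).-integrable setT (EFin \o (fun t =>
    \sum_(n < N) rate (kappa w) (stage n w) * (tail w n t - tail w n.+1 t))).
  by apply: integrable_sum_EFin => // n; exact: id.
have iN : (@lebesgue_measure R).-integrable setT
    (EFin \o (fun t => s * rate_bound * tail w N t)).
  by have := integrableZl measurableT (s * rate_bound) (integrable_tail w N).
have iall : (@lebesgue_measure R).-integrable setT (EFin \o (fun t =>
    \sum_(n < N) rate (kappa w) (stage n w) * (tail w n t - tail w n.+1 t)
    + s * rate_bound * tail w N t)).
  by apply: eq_integrable (integrableD measurableT isum iN).
have istep : (@lebesgue_measure R).-integrable setT (EFin \o step w N s).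
  by have := integrableZl measurableT alpha^-1 iall.
rewrite -[LHS]fineK; last exact: integrable_fin_num.
congr EFin; rewrite -/(Rintegral _ _ _) /step RintegralZl// RintegralD//.
rewrite Rintegral_sum// RintegralZl// tailR mulrDr; congr (_ + _).
  congr (_ * _); apply: eq_bigr => n _.
  rewrite RintegralZl//; last first.
    by apply: eq_integrable (integrableB measurableT (integrable_tail w n) (integrable_tail w n.+1)).
  by rewrite RintegralB// !tailR.
by rewrite !mulrA [alpha^-1 * s]mulrC -!mulrA (mulrCA alpha^-1).
Qed.

(** The integrand lies pointwise between the two functions [step], whose integrals are explicit;
    [le_integral_nomeas] compares the integrals. *)
Lemma path_payoff_bounds N (w : Om) :
  ((partial_payoff N w - rate_bound / alpha * discount alpha N w)%:E
     <= path_payoff w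
     <= (partial_payoff N w + rate_bound / alpha * discount alpha N w)%:E)%E.
Proof.
rewrite -[X in (_ - X)%:E]mul1r -mulNr -integral_step.
rewrite -[X in (_ + X)%:E]mul1r -integral_step.
rewrite /path_payoff [X in (_ <= X <= _)%E]integral_mkcond.
set h := (fun t => _) \_ _.
have e0 t : 0 <= e t by rewrite mulr_ge0 ?expR_ge0// ltW.
have stepE t s : step w N s t = alpha^-1 * e t *
   (\sum_(n < N) rate (kappa w) (stage n w) *
      ((T n w <= t)%R%:R - (T n.+1 w <= t)%R%:R) + s * rate_bound * (T N w <= t)%R%:R).
  rewrite /step -[RHS]mulrA; congr (_ * _); rewrite mulrDr.
  congr (_ + _); last by rewrite tailE mulrCA.
  by rewrite mulr_sumr; apply: eq_bigr => n _; rewrite !tailE -mulrBr mulrCA.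
have ae0 t : 0 <= alpha^-1 * e t by rewrite mulr_ge0// invr_ge0 ltW.
suff hE t : ((step w N (-1) t)%:E <= h t <= (step w N 1 t)%:E)%E.
  by apply/andP; split; apply: le_integral_nomeas => t _; have /andP[] := hE t.
rewrite /h patchE !stepE; case: ifPn => [|tD].
  rewrite inE/= => -[t0 tT]; rewrite !lee_fin.
  have -> : expR (- (alpha * t)) = alpha^-1 * e t.
    by rewrite /e mulKf// gt_eqF.
  rewrite -[Xt t w]/((stage (epoch t w) w).1.1).
  rewrite -[At t w]/((stage (epoch t w) w).1.2) -[Bt t w]/((stage (epoch t w) w).2).
  (* The indicators leave only the stage in progress at time t, provided it comes before N. *)
  have sumE : \sum_(n < N) rate (kappa w) (stage n w) *
      ((T n w <= t)%R%:R - (T n.+1 w <= t)%R%:R) =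
      if (epoch t w < N)%N then rate (kappa w) (stage (epoch t w) w) else 0.
    transitivity (\sum_(n < N | n == epoch t w :> nat)
        rate (kappa w) (stage n w)).
      rewrite [RHS]big_mkcond; apply: eq_bigr => n _.
      rewrite !(reached_epoch _ t0 tT); case: ltngtP => _;
        by rewrite ?subrr ?subr0 ?mulr0 ?mulr1.
    case: ltnP => eN.
      by rewrite (big_pred1 (Ordinal eN)).
    by rewrite big1// => n /eqP ne; move: eN; rewrite -ne leqNgt ltn_ord.
  rewrite -/(rate _ _) !(ler_wpM2l (ae0 t))//.
  - rewrite sumE (reached_epoch _ t0 tT) mul1r; case: ltnP => _ /=.
      by rewrite mulr0 addr0.
    by rewrite mulr1 add0r (le_trans (ler_norm _))// rate_le.
  - rewrite sumE (reached_epoch _ t0 tT) mulN1r; case: ltnP => _ /=.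
      by rewrite mulr0 addr0.
    rewrite mulr1 add0r lerNl (le_trans _ (rate_le (kappa w) (stage (epoch t w) w)))//.
    by rewrite -normrN ler_norm.
(* Outside the domain the restricted integrand takes the default [point] of the extended reals,
   which is 0. There, either t < 0 and no jump time is reached, or T_infty <= t and all are; in both
   cases the differences cancel. *)
rewrite -[point]/(0%E).
suff Tt : (forall n, (T n w <= t) = (T 0 w <= t)).
  rewrite big1 ?add0r => [|n _]; last by rewrite !Tt subrr mulr0.
  rewrite mulN1r !mulNr mulrN mul1r !lee_fin oppr_le0 andbb.
  by rewrite mulr_ge0// mulr_ge0// rate_bound_ge0.
move=> n; rewrite {2}/T big_ord0; case: (leP 0 t) => t0; last first.
  by apply/negbTE; rewrite -ltNge (lt_le_trans t0)// T_ge0.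
rewrite -lee_fin; apply: (@le_trans _ _ (Tinfty w)).
  by rewrite TinftyE; apply: ereal_sup_ubound; exists n.
by rewrite leNgt; apply/negP => tT; move/negP: tD; apply; rewrite inE.
Qed.

End Pathwise.

Lemma measurable_kappa_stage (R : realType) (K S A B : pointedFinType)
    (phi : K -> S * A * B -> R) n :
  measurable_fun setT (fun w : Omega R K S A B => phi (kappa w) (stage n w)).
Proof.
move=> _ C mC; rewrite setTI.
rewrite (_ : _ @^-1` C = \bigcup_(k in [set: K])
  ([set w : Omega R K S A B | kappa w = k] `&`
   [set w : Omega R K S A B | [set y | C (phi k y)] (stage n w)])).
  apply: fin_bigcup_measurable; first exact: finite_finset.
  move=> k _; apply: measurableI; first exact: measurable_kappa.
  exact: measurable_stage.
apply/seteqP; split => w /=.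
  by move=> Cw; exists (kappa w).
by case=> k _ [/= <-].
Qed.

(** * Expected payoffs, with an error uniform in the policies *)

Section Expectation.
Variables (R : realType) (K S A B : pointedFinType).
Local Notation Om := (Omega R K S A B).
Variables (Q : R -> S -> S -> A -> B -> R) (hQ : semi_markov_kernel Q).
Variables (c : K -> S -> A -> B -> R) (z : K -> R).
Variables (alpha : R) (nu : probability (measurableTypeR R) R).
Hypothesis alpha_gt0 : 0 < alpha.
Hypothesis nu_tail : forall a, 0 <= a ->
  nu `[a, +oo[%classic = (expR (- (alpha * a)))%:E.
Variables (r : R) (r_ge0 : 0 <= r).
Hypothesis total_le : forall i a b, \sum_j kernel_transform Q nu j i a b <= r.
Variables (p : dist R K) (i : S) (pi : policy1 R K S A B).
Variables (sigma : policy2 R S A B) (P : probability Om R).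
Hypothesis law : is_law Q p i pi sigma P.

Local Notation total := (total_transform Q nu).
Local Notation sw := (stage_weight Q nu p i pi sigma).
Local Notation g := (rate c z).
Local Notation M := (rate_bound c z).

(** The measure P is absent, so the dependence on [sigma] is explicit and polynomial. The factor 1 -
    [total] accounts for the discount lost during one sojourn. *)
Definition expected_partial_payoff N : R :=
  alpha^-1 * \sum_(n < N) \sum_(y : K * history S A B n * A * B)
    g y.1.1.1 (y.1.1.2.2, y.1.2, y.2) * ((1 - total y) * sw y).

Lemma stage_weight_ge0 n (y : K * history S A B n * A * B) : 0 <= sw y.
Proof.
rewrite -(stage_weightE hQ alpha_gt0 nu_tail law).
by apply: Rintegral_ge0 => w _; exact: expR_ge0.
Qed.

(** On each stage event, passing from T_N to T_{N+1} multiplies the mean discount by [total], which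
    is at most r. *)
Lemma mean_discount_le N : \int[P]_w discount alpha N w <= r ^+ N.
Proof.
have mass n m : \int[P]_w discount alpha m w =
    \sum_(y : K * history S A B n * A * B)
      \int[P]_(w in stage_event y) discount alpha m w.
  transitivity (\int[P]_w (1 * discount alpha m w)).
    by apply: eq_Rintegral => w _; rewrite mul1r.
  rewrite (stage_partition alpha_gt0 P (fun _ _ => 1) n m).
  by apply: eq_bigr => y _; rewrite mul1r.
elim: N => [|N IHN].
  rewrite expr0 (_ : Rintegral _ _ _ = \int[P]_w 1).
    by rewrite Rintegral_cst// mul1r (congr1 fine (probability_setT P) : fine (P _) = 1).
  by apply: eq_Rintegral => w _; rewrite /discount /T big_ord0 mulr0 oppr0 expR0.
rewrite (mass N) exprS (le_trans _ (ler_wpM2l r_ge0 IHN))// (mass N) mulr_sumr.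
apply: ler_sum => y _.
rewrite (stage_discount_succ hQ alpha_gt0 nu_tail law).
rewrite (stage_weightE hQ alpha_gt0 nu_tail law).
by apply: ler_wpM2r; [exact: stage_weight_ge0|exact: total_le].
Qed.

Let integrable_rate n m : P.-integrable setT
  (EFin \o (fun w : Om => g (kappa w) (stage n w) * discount alpha m w)).
Proof.
apply: (@bounded_integrable _ _ _ _ _ _ M) => //.
  apply: measurable_funM; first exact: measurable_kappa_stage.
  exact: measurable_discount.
move=> w; rewrite normrM -[leRHS]mulr1 ler_pM// ?rate_le//.
exact: discount_bound.
Qed.

Let integrable_diff n : P.-integrable setT
  (EFin \o (fun w : Om => g (kappa w) (stage n w) *
    (discount alpha n w - discount alpha n.+1 w))).
Proof.
apply: eq_integrable (integrableB measurableT (integrable_rate n n)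
  (integrable_rate n n.+1)) => // w _ /=.
by rewrite -EFinB mulrBr.
Qed.

Let integrable_partial N :
  P.-integrable setT (EFin \o (partial_payoff c alpha z N)).
Proof.
by have := integrableZl measurableT alpha^-1
  (integrable_sum_EFin (index_enum 'I_N) measurableT (fun n => integrable_diff n)).
Qed.

Lemma expected_partial_payoffE N :
  \int[P]_w partial_payoff c alpha z N w = expected_partial_payoff N.
Proof.
rewrite /partial_payoff RintegralZl//; last first.
  by apply: integrable_sum_EFin => // n; exact: integrable_diff.
congr (_ * _); rewrite Rintegral_sum//; apply: eq_bigr => n _.
transitivity (\int[P]_w (g (kappa w) (stage n w) * discount alpha n w) -
    \int[P]_w (g (kappa w) (stage n w) * discount alpha n.+1 w)).
  by rewrite -RintegralB//; apply: eq_Rintegral => w _; rewrite mulrBr.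
rewrite !(stage_partition alpha_gt0 P g n) -sumrB; apply: eq_bigr => y _.
rewrite (stage_discount_succ hQ alpha_gt0 nu_tail law).
rewrite (stage_weightE hQ alpha_gt0 nu_tail law).
by rewrite (mulrBl _ 1 (total y)) mul1r mulrBr.
Qed.

(** Integrates [path_payoff_bounds] and bounds the mean error by [mean_discount_le]. The error is
    the same for all policies, which is what continuity in [sigma] requires. *)
Lemma payoff_bounds N :
  ((expected_partial_payoff N - M / alpha * r ^+ N)%:E <=
     \int[P]_w path_payoff c alpha z w <=
   (expected_partial_payoff N + M / alpha * r ^+ N)%:E)%E.
Proof.
have Ma0 : 0 <= M / alpha.
  by rewrite mulr_ge0 ?rate_bound_ge0// invr_ge0 ltW.
have id : P.-integrable setT (EFin \o (fun w => M / alpha * discount alpha N w)).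
  have := integrableZl measurableT (M / alpha) (bounded_integrable P measurableT
    (measurable_discount alpha N) (discount_bound alpha_gt0 N)).
  by [].
have dle : \int[P]_w (M / alpha * discount alpha N w) <= M / alpha * r ^+ N.
  rewrite RintegralZl//; last first.
    exact: (bounded_integrable P measurableT
      (measurable_discount alpha N) (discount_bound alpha_gt0 N)).
  by rewrite ler_wpM2l// mean_discount_le.
apply/andP; split.
- apply: (@le_trans _ _ (\int[P]_w (partial_payoff c alpha z N w -
      M / alpha * discount alpha N w)%:E)%E); last first.
    apply: le_integral_nomeas => w _.
    by have /andP[] := path_payoff_bounds c alpha_gt0 z N w.
  rewrite -[leRHS]fineK; last first.
    apply: integrable_fin_num => //.
    by apply: eq_integrable (integrableB measurableT (integrable_partial N) id).
  rewrite -/(Rintegral _ _ _) RintegralB// expected_partial_payoffE lee_fin.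
  by rewrite lerB.
- apply: (@le_trans _ _ (\int[P]_w (partial_payoff c alpha z N w +
      M / alpha * discount alpha N w)%:E)%E).
    apply: le_integral_nomeas => w _.
    by have /andP[] := path_payoff_bounds c alpha_gt0 z N w.
  rewrite -[leLHS]fineK; last first.
    apply: integrable_fin_num => //.
    by apply: eq_integrable (integrableD measurableT (integrable_partial N) id).
  rewrite -/(Rintegral _ _ _) RintegralD// expected_partial_payoffE lee_fin.
  by rewrite lerD.
Qed.

End Expectation.

(** * Limits of policies along an ultrafilter *)

(** Compactness gives a cluster point, and along an ultrafilter a cluster point is a limit: the
    preimage of a neighbourhood or its complement belongs to F, and clustering excludes the
    complement. *)
Lemma ultra_cvg_compact (T : Type) (V : topologicalType) (F : set_system T)
    (C : set V) (f : T -> V) :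
  UltraFilter F -> compact C -> (forall t, C (f t)) ->
  exists2 l, C l & f @ F --> l.
Proof.
move=> UF cC fC; have FC : F (f @^-1` C).
  by apply: (filterS (P := setT)); [move=> t _; exact: fC|exact: filterT].
have [l [Cl clusterl]] := cC (f @ F) _ FC.
exists l => // B Bl; have [//|FnB] := in_ultra_setVsetC (f @^-1` B) UF.
by have [x [nBx /nBx]] := clusterl (~` B) B FnB Bl.
Qed.

Lemma cvg_sum_ring (R : realType) (T I : Type) (F : set_system T) (s : seq I)
    (f : I -> T -> R) (l : I -> R) :
  Filter F -> (forall i, f i x @[x --> F] --> l i) ->
  \sum_(i <- s) f i x @[x --> F] --> \sum_(i <- s) l i.
Proof. by move=> FF fl; apply: cvg_big => //; exact: add_continuous. Qed.

Lemma dist_inhabited (R : realType) (E : pointedFinType) : inhabited (dist R E).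
Proof.
have d0 (e : E) : 0 <= (e == point)%:R :> R by [].
constructor; apply: (Dist d0).
by rewrite (bigD1 point)//= eqxx big1 ?addr0// => e /negbTE ->.
Qed.

(** Every mass lies in the compact interval [0, 1] and so converges; the finite sum of the masses
    passes to the limit and stays 1. *)
Lemma ultra_limit_dist (R : realType) (E : finType) (T : Type)
    (F : set_system T) (mu : T -> dist R E) :
  UltraFilter F ->
  exists l : dist R E, forall e, mu t e @[t --> F] --> l e.
Proof.
move=> UF; have le1 t e : mu t e <= 1.
  rewrite -(mass_sum1 (mu t)) (bigD1 e)//= lerDl.
  by apply: sumr_ge0 => *; exact: mass_ge0.
have /choice[l lP] : forall e, exists l : R, 0 <= l /\ mu t e @[t --> F] --> l.
  move=> e; have [t|l] := ultra_cvg_compact (f := fun t => mu t e) UF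
    (@segment_compact R 0 1).
    by rewrite /= in_itv/= mass_ge0 le1.
  by rewrite /= in_itv/= => /andP[l0 _]; exists l.
have l1 : \sum_e l e = 1.
  have cl : (fun=> 1 : R) @ F --> \sum_e l e.
    rewrite (_ : (fun=> 1) = (fun t => \sum_e mu t e)).
      by apply: cvg_sum_ring => e; exact: (lP e).2.
    by apply/funext => t; rewrite mass_sum1.
  exact: (cvg_unique (@norm_hausdorff _ _) cl (cvg_cst _)).
by exists (Dist (fun e => (lP e).1) l1) => e; exact: (lP e).2.
Qed.

(** * Continuity of truncated payoffs in the policy of Player 2 *)

Section Continuity.
Variables (R : realType) (K S A B : pointedFinType).
Variables (Q : R -> S -> S -> A -> B -> R).
Variables (c : K -> S -> A -> B -> R) (z : K -> R) (alpha : R).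
Variable (nu : probability (measurableTypeR R) R).
Variables (p : dist R K) (i : S) (pi : policy1 R K S A B).
Variables (T : Type) (F : set_system T) (FF : Filter F).
Variables (s : T -> policy2 R S A B) (sigma : policy2 R S A B).
Hypothesis s_sigma : forall n (h : history S A B n) b, start h = i ->
  s t h b @[t --> F] --> sigma h b.

(** A product of convergent factors, by induction. On histories that do not start at i, where
    nothing is assumed of [s], the weights are constantly 0. *)
Lemma weight_cvg k n (h : history S A B n) :
  weight Q nu p i pi (s t) k h @[t --> F] --> weight Q nu p i pi sigma k h.
Proof.
elim: n h => [|n IHn] h /=; first exact: cvg_cst.
apply: cvgM; first exact: cvg_cst.
have [hi|hi] := eqVneq (start (prev h)) i; last first.
  rewrite (weight_start Q nu p pi sigma k hi) mulr0.
  under eq_cvg do rewrite (weight_start Q nu p pi _ k hi) mulr0.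
  exact: cvg_cst.
apply: cvgM => //; apply: cvgM; first exact: cvg_cst.
exact: s_sigma.
Qed.

Lemma expected_partial_payoff_cvg N :
  expected_partial_payoff Q c z alpha nu p i pi (s t) N @[t --> F] -->
  expected_partial_payoff Q c z alpha nu p i pi sigma N.
Proof.
apply: cvgM; first exact: cvg_cst.
apply: cvg_sum_ring => n; apply: cvg_sum_ring => y.
apply: cvgM; first exact: cvg_cst.
apply: cvgM; first exact: cvg_cst.
rewrite /stage_weight.
have [hi|hi] := eqVneq (start y.1.1.2) i; last first.
  rewrite (weight_start Q nu p pi sigma _ hi) mulr0.
  under eq_cvg do rewrite (weight_start Q nu p pi _ _ hi) mulr0.
  exact: cvg_cst.
apply: cvgM; last exact: weight_cvg.
by apply: cvgM; [exact: cvg_cst|exact: s_sigma].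
Qed.

End Continuity.

(** * Construction of the optimal policy *)

Theorem theorem5p8 (R : realType) (K S A B : pointedFinType)
    (Q : R -> S -> S -> A -> B -> R) (hQ : semi_markov_kernel Q)
    (c : K -> S -> A -> B -> R) (hc : forall k i a b, 0 <= c k i a b)
    (alpha : R) (halpha : 0 < alpha)
    (P : dist R K -> S -> policy1 R K S A B -> policy2 R S A B ->
         probability (Omega R K S A B) R)
    (hP : forall p i pi sigma, is_law Q p i pi sigma (P p i pi sigma))
    (delta epsilon : R) (hdelta : 0 < delta)
    (hepsilon : 0 < epsilon < 1)
    (hD : forall i a b, sojourn_cdf Q delta i a b <= 1 - epsilon)
    (z : K -> R) :
  exists sigma : policy2 R S A B,
    (forall (Ustar : S -> \bar R),
       (forall i, is_value c alpha P z i (Ustar i)) ->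
       forall i (rp : dual_policy1 R K S A B),
         (dual_payoff c alpha P z i rp sigma <= Ustar i)%E) /\
    optimal2 c alpha P z sigma.
Proof.
suff [sigma sigma_opt] : exists sigma, optimal2 c alpha P z sigma.
  exists sigma; split => // Ustar UstarP i rp.
  have [_ <-] := UstarP i; apply: le_trans (sigma_opt i).
  by apply: ereal_sup_ubound; exists rp.
have [nu nu_tail] := exponential_law halpha.
pose r := contraction alpha delta epsilon.
have /andP[r0 r1] : 0 <= r < 1 by exact: contraction_bounds.
have total_le i a b : \sum_j kernel_transform Q nu j i a b <= r.
  exact: sum_kernel_transform.
pose worst i sigma := ereal_sup (range (fun rp => dual_payoff c alpha P z i rp sigma)).
have /choice[s sP] : forall i, exists s : nat -> policy2 R S A B,
    worst i (s m) @[m --> \oo] --> upper_value c alpha P z i.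
  move=> i; have [|u uS ucvg] := @ereal_inf_seq R (range (worst i)).
    have [d] := dist_inhabited R B.
    by apply/set0P; exists (worst i (fun _ _ => d)), (fun _ _ => d).
  have /choice[s sE] : forall m, exists sg, worst i sg = u m.
    by move=> m; have [sg _ <-] := uS m; exists sg.
  by exists s; under eq_cvg do rewrite sE.
(* F refines the filter of cofinal segments, so limits as m -> oo persist along F. Being an
   ultrafilter, it makes all the action probabilities converge at once, with no diagonal
   extraction. *)
have [F [UF ooF]] := ultraFilterLemma eventually_filter.
have FF : Filter F by exact: filter_filter.
(* Pairing n with h lets one choice cover all lengths. Since h follows the sequence of [start h], on
   histories from i the result is the limit of [s i], for every i simultaneously. *)
have /choice[l lP] : forall nh : {n & history S A B n}, exists l : dist R B,
    forall b, s (start (tagged nh)) m (tag nh) (tagged nh) b @[m --> F] --> l b.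
  by move=> nh; exact: ultra_limit_dist.
pose sigma : policy2 R S A B := fun n h => l (Tagged _ h).
exists sigma => i; apply/ge_ereal_sup => _ [rp _ <-].
have slim n (h : history S A B n) b : start h = i ->
    s i m n h b @[m --> F] --> sigma n h b.
  by move=> <-; exact: (lP (Tagged _ h)).
set C := rate_bound c z / alpha.
have bounds sg N := payoff_bounds hQ c z halpha nu_tail r0 total_le
  (hP (rp.1 i) i rp.2 sg) N.
(* The bounds at N = 0 already have finite ends. *)
have fin sg : dual_payoff c alpha P z i rp sg \is a fin_num.
  have /andP[lo up] := bounds sg 0%N.
  by rewrite fin_numElt (lt_le_trans _ lo) ?ltNyr// (le_lt_trans up) ?ltry.
have dist_le sg N : `|fine (dual_payoff c alpha P z i rp sg) -
    expected_partial_payoff Q c z alpha nu (rp.1 i) i rp.2 sg N| <= C * r ^+ N.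
  have := bounds sg N; rewrite -[integral _ _ _]/(dual_payoff c alpha P z i rp sg).
  by rewrite -(fineK (fin sg)) !lee_fin ler_distl.
have payoff_cvg : fine (dual_payoff c alpha P z i rp (s i m)) @[m --> F] -->
    fine (dual_payoff c alpha P z i rp sigma).
  apply/cvgrPdist_le => e e0.
  (* A third of e for each truncation error, at [sigma] and at [s i m]; the last third is for the
     convergence of the truncated payoffs at this N. *)
  have [N CN] : exists N, C * r ^+ N <= e / 3.
    have : C * r ^+ N @[N --> \oo] --> C * 0.
      by apply: cvgM; [exact: cvg_cst|apply: cvg_expr; rewrite ger0_norm].
    rewrite mulr0 => /cvgrPdist_le /(_ (e / 3)) [|N _ HN]; first by rewrite divr_gt0.
    exists N; have := HN N (leqnn N); rewrite /= sub0r normrN.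
    exact: le_trans (ler_norm _).
  have := expected_partial_payoff_cvg FF slim (N := N) (Q := Q) (c := c) (z := z)
    (alpha := alpha) (nu := nu) (p := rp.1 i) (pi := rp.2).
  move=> /cvgrPdist_le /(_ (e / 3)); rewrite divr_gt0// => /(_ isT).
  apply: filterS => m Hm.
  have H1 := le_trans (dist_le sigma N) CN.
  have H2 := le_trans (dist_le (s i m) N) CN.
  move: Hm H1 H2; rewrite !ler_distl => /andP[? ?] /andP[? ?] /andP[? ?].
  by apply/andP; split; lra.
rewrite -(fineK (fin sigma)).
have sF : worst i (s i m) @[m --> F] --> upper_value c alpha P z i.
  by apply: cvg_trans (sP i) => X /ooF.
(* Against the fixed [rp], the payoff of [s i m] is at most its worst case; both sides converge
   along F, the right one to the upper value. *)
apply: (lee_cvg_to (a := F) (f := fun m => dual_payoff c alpha P z i rp (s i m)) _ sF).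
  by apply: cvg_EFin payoff_cvg; apply: nearW => m; exact: fin.
by apply: nearW => m; apply: ereal_sup_ubound; exists rp.
Qed.
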